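(* Let $\nu>3$, and let $0<d_{\nu,1}<\ldots<d_{\nu,N}$ be the strictly positive zeros of $D_\nu$. For every $n\in\{1,\ldots,N-1\}$, the function $\Pi_\nu$ has exactly one critical point $\gamma_{\nu,n}\in(d_{\nu,n},d_{\nu,n+1})$, which is a strict minimum. If $\delta_{\nu,n}=\Pi_\nu(\gamma_{\nu,n})$, then $$1>\delta_{\nu,1}>\delta_{\nu,2}>\ldots>\delta_{\nu,N-1}>0.$$ Consequently, for all $n\in\{1,\ldots,N-1\}$ and $x\in(d_{\nu,n},d_{\nu,n+1})$, $$D_\nu^2(x)-D_{\nu-1}(x)D_{\nu+1}(x)\ge\delta_{\nu,n}D_\nu^2(x),$$ where $\delta_{\nu,n}$ is the best possible constant.
   Context: $D_\nu(x)=U\left(-\nu-\frac12,x\right)$ is the parabolic cylinder function, i.e. the solution of $D_\nu''(x)+\left(\nu+\frac12-\frac{x^2}{4}\right)D_\nu(x)=0$ with $D_\nu(x)\sim x^\nu e^{-x^2/4}$ as $x\to+\infty$. $N=N_+(\nu)$ is the number of strictly positive zeros of $D_\nu$ (a zero at the origin is not counted); $N_+(\nu)=k$ when $2k-1<\nu\le2k+1$, $k\in\mathbb N$, so $N\ge2$ for $\nu>3$. Where $D_\nu(x)\ne0$, $$\Pi_\nu(x)=1-\frac{D_{\nu-1}(x)D_{\nu+1}(x)}{D_\nu^2(x)}.$$ *)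

(* Defs.v *)
(* Stdlib reals with Coquelicot. *)
From Stdlib Require Import Reals.
From Coquelicot Require Import Coquelicot.
Open Scope R_scope.

(* [is_parabolic_cylinder nu f] says that [f] is D_nu = U(-nu-1/2, .) on the
   real line.  The asymptotics select the recessive solution at +oo and fix its
   scale, so [f] is unique.  [ex_derive] is required separately because
   Coquelicot's [Derive] is total. *)
Definition is_parabolic_cylinder (nu : R) (f : R -> R) : Prop :=
  (forall x, ex_derive f x) /\
  (forall x, ex_derive (Derive f) x) /\
  (forall x, Derive (Derive f) x + (nu + 1 / 2 - x ^ 2 / 4) * f x = 0) /\
  is_lim (fun x => f x / (Rpower x nu * exp (- (x ^ 2 / 4)))) p_infty 1.

(* Meaningful only where [D nu x <> 0]. *)
Definition Pi_turan (D : R -> R -> R) (nu x : R) : R :=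
  1 - D (nu - 1) x * D (nu + 1) x / (D nu x) ^ 2.

(* [d 1 < ... < d N] are all the strictly positive zeros of [f]; the values of
   [d] outside 1..N are irrelevant. *)
Definition enumerates_positive_zeros (f : R -> R) (N : nat) (d : nat -> R) : Prop :=
  (forall n, (1 <= n <= N)%nat -> 0 < d n /\ f (d n) = 0) /\
  (forall n, (1 <= n < N)%nat -> d n < d (S n)) /\
  (forall x, 0 < x -> f x = 0 -> exists n, (1 <= n <= N)%nat /\ x = d n).

Definition is_critical_point (f : R -> R) (x : R) : Prop := is_derive f x 0.

Definition is_strict_min_on (f : R -> R) (a b c : R) : Prop :=
  a < c < b /\ (forall x, a < x < b -> x <> c -> f c < f x).

(* Main.v *)
Require Import Defs.
From Stdlib Require Import Reals Ranalysis5 Lra Lia ClassicalEpsilon.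
From Coquelicot Require Import Coquelicot.
Open Scope R_scope.

(** Write y = D_nu and h = y'/y.  The ladder relations
    nu D_(nu-1) = y' + x y / 2 and D_(nu+1) = x y / 2 - y' turn the quotient
    into K := nu Pi_nu = nu - x^2/4 + h^2, a function of x and h alone, and the
    Riccati equation for h reads h' = - K - 1/2.  Everything then takes place
    between two consecutive positive zeros a < b of y.

    Positivity.  T := y^2 K satisfies T' = - y (y' + x y / 2), so at an interior
    minimum of T on [a, b] one has y' = - x y / 2 and hence T = nu y^2 > 0;
    since T is a square at a and b, K > 0 on (a, b) ([turan_positive]).

    One critical point.  S := y^2 K' satisfies S' = 2 y^2 K (K + 1) > 0
    ([turan_slope_increasing]), so K' changes sign at most once, from minus to
    plus.  Rolle's theorem for y gives a point where S < 0 and Rolle's theorem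
    for y exp (x^2/4) gives a point where S > 0; so there is exactly one zero
    ([turan_slope_zero]), and it is a strict minimum.

    Monotonicity.  At the critical point c, K' = 0 means h = - c / (2 (2K + 1)),
    and the definition of K becomes
    nu = K + c^2/4 (1 - 1/(2K+1)^2), whose right-hand side increases both in c
    and in K > 0.  As c moves to the right through the successive intervals, K
    must decrease, and 0 < K < nu ([critical_value_decreasing]).

    The ladder relations have to be deduced from the characterization of D_mu by
    its differential equation and its asymptotics.  The function y' + x y / 2
    solves the equation of parameter nu - 1; that it is asymptotic to
    nu x^(nu-1) exp (-x^2/4) is a l'Hopital argument based on
    ((y' + x y / 2) exp (-x^2/4))' = - nu y exp (-x^2/4)
    ([is_lim_lowered_scale]).  The same asymptotics show that the Wronskian of
    two solutions with the prescribed behaviour tends to 0, so it vanishes and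
    the solutions coincide ([parabolic_cylinder_unique]).  The ladder functions
    are therefore D_(nu-1) and D_(nu+1). *)

(** * Monotonicity, limits at infinity and l'Hopital's rule *)

Lemma nondecreasing_of_derive (F dF : R -> R) (a b : R) :
  a <= b ->
  (forall x, a <= x <= b -> is_derive F x (dF x)) ->
  (forall x, a <= x <= b -> 0 <= dF x) ->
  F a <= F b.
Proof.
  intros Hab HF Hpos.
  destruct (MVT_gen F a b dF) as [c [Hc Heq]].
  - rewrite Rmin_left, Rmax_right by lra. intros x Hx. apply HF; lra.
  - rewrite Rmin_left, Rmax_right by lra. intros x Hx.
    apply continuity_pt_filterlim, (ex_derive_continuous F x).
    exists (dF x). now apply HF.
  - rewrite Rmin_left, Rmax_right in Hc by lra.
    specialize (Hpos c Hc). nra.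
Qed.

Lemma increasing_of_derive (F dF : R -> R) (a b : R) :
  a < b ->
  (forall x, a <= x <= b -> is_derive F x (dF x)) ->
  (forall x, a <= x <= b -> 0 < dF x) ->
  F a < F b.
Proof.
  intros Hab HF Hpos.
  destruct (MVT_gen F a b dF) as [c [Hc Heq]].
  - rewrite Rmin_left, Rmax_right by lra. intros x Hx. apply HF; lra.
  - rewrite Rmin_left, Rmax_right by lra. intros x Hx.
    apply continuity_pt_filterlim, (ex_derive_continuous F x).
    exists (dF x). now apply HF.
  - rewrite Rmin_left, Rmax_right in Hc by lra.
    specialize (Hpos c Hc). nra.
Qed.

Lemma is_lim_p_infty_eps (F : R -> R) (l : R) :
  is_lim F p_infty l ->
  forall eps, 0 < eps -> exists M, forall x, M < x -> Rabs (F x - l) < eps.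
Proof.
  intros H eps Heps. apply is_lim_spec in H.
  exact (H (mkposreal eps Heps)).
Qed.

Lemma eps_is_lim_p_infty (F : R -> R) (l : R) :
  (forall eps, 0 < eps -> exists M, forall x, M < x -> Rabs (F x - l) <= eps) ->
  is_lim F p_infty l.
Proof.
  intros H. apply is_lim_spec. intros eps.
  destruct (H (eps / 2)) as [M HM]; [apply is_pos_div_2 |].
  exists M. intros x Hx. specialize (HM x Hx).
  destruct eps as [e He]; simpl in *; lra.
Qed.

Lemma is_lim_mult_finite (F G : R -> R) (l m : R) :
  is_lim F p_infty l -> is_lim G p_infty m ->
  is_lim (fun x => F x * G x) p_infty (l * m).
Proof. intros HF HG. exact (is_lim_mult _ _ _ _ _ HF HG I). Qed.

Lemma is_lim_div_finite (F G : R -> R) (l m : R) :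
  m <> 0 -> is_lim F p_infty l -> is_lim G p_infty m ->
  is_lim (fun x => F x / G x) p_infty (l / m).
Proof.
  intros Hm HF HG. apply is_lim_mult_finite; [assumption |].
  apply (is_lim_inv _ _ _ HG). intros H. apply Hm. now injection H.
Qed.

Lemma is_lim_p_infty_ext (F G : R -> R) (M : R) (l : Rbar) :
  (forall x, M < x -> F x = G x) -> is_lim F p_infty l -> is_lim G p_infty l.
Proof. intros H. apply is_lim_ext_loc. now exists M. Qed.

Lemma is_lim_inv_sq : is_lim (fun x => / x ^ 2) p_infty 0.
Proof.
  apply eps_is_lim_p_infty. intros eps Heps.
  exists (Rmax 1 (/ eps)). intros x Hx.
  pose proof (Rmax_l 1 (/ eps)). pose proof (Rmax_r 1 (/ eps)).
  assert (0 < / eps) by now apply Rinv_0_lt_compat.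
  rewrite Rminus_0_r, Rabs_pos_eq by (apply Rlt_le, Rinv_0_lt_compat; nra).
  rewrite <- (Rinv_inv eps). apply Rinv_le_contravar; [assumption | nra].
Qed.

Lemma nondecreasing_le_lim (F dF : R -> R) (M l : R) :
  (forall x, M < x -> is_derive F x (dF x)) ->
  (forall x, M < x -> 0 <= dF x) ->
  is_lim F p_infty l ->
  forall x, M < x -> F x <= l.
Proof.
  intros HF Hpos Hl x Hx.
  destruct (Rle_or_lt (F x) l) as [H | H]; [assumption | exfalso].
  destruct (is_lim_p_infty_eps _ _ Hl (F x - l)) as [M' HM']; [lra |].
  set (y := Rmax x M' + 1).
  assert (Hy : x < y /\ M' < y).
  { unfold y. pose proof (Rmax_l x M'). pose proof (Rmax_r x M'). lra. }
  assert (F x <= F y).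
  { apply nondecreasing_of_derive with dF; [lra | |]; intros t Ht;
      [apply HF | apply Hpos]; lra. }
  specialize (HM' y (proj2 Hy)). apply Rabs_def2 in HM'. lra.
Qed.

(** The bounds (l + eps) dH <= dF <= (l - eps) dH make F - (l + eps) H and
    (l - eps) H - F monotone; both tend to 0, which gives their signs. *)
Lemma lhopital_p_infty (F dF H dH : R -> R) (M l : R) :
  (forall x, M < x -> is_derive F x (dF x)) ->
  (forall x, M < x -> is_derive H x (dH x)) ->
  (forall x, M < x -> 0 < H x) ->
  (forall x, M < x -> dH x < 0) ->
  is_lim F p_infty 0 -> is_lim H p_infty 0 ->
  is_lim (fun x => dF x / dH x) p_infty l ->
  is_lim (fun x => F x / H x) p_infty l.
Proof.
  intros HF HH Hpos HdH LF LH Lq.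
  apply eps_is_lim_p_infty. intros eps Heps.
  destruct (is_lim_p_infty_eps _ _ Lq eps Heps) as [M' HM'].
  set (M1 := Rmax M M').
  assert (HM1 : M <= M1 /\ M' <= M1) by (split; [apply Rmax_l | apply Rmax_r]).
  assert (Hbd : forall x, M1 < x ->
            (l + eps) * dH x <= dF x <= (l - eps) * dH x).
  { intros x Hx. specialize (HM' x ltac:(lra)). specialize (HdH x ltac:(lra)).
    apply Rabs_def2 in HM'.
    replace (dF x) with (dF x / dH x * dH x) by (field; lra). nra. }
  exists M1. intros x Hx.
  assert (Hlow : (l - eps) * H x - F x <= 0).
  { apply (nondecreasing_le_lim (fun t => (l - eps) * H t - F t)
             (fun t => (l - eps) * dH t - dF t) M1); [| | | assumption].
    - intros t Ht. apply (is_derive_minus (V := R_NormedModule));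
        [apply (is_derive_scal H) |]; auto with real.
      + apply HH; lra.
      + apply HF; lra.
    - intros t Ht. specialize (Hbd t Ht). lra.
    - replace (Finite 0) with (Finite ((l - eps) * 0 - 0)) by (f_equal; ring).
      apply is_lim_minus'; [| assumption].
      apply (is_lim_scal_l H (l - eps) p_infty 0 LH). }
  assert (Hup : F x - (l + eps) * H x <= 0).
  { apply (nondecreasing_le_lim (fun t => F t - (l + eps) * H t)
             (fun t => dF t - (l + eps) * dH t) M1); [| | | assumption].
    - intros t Ht. apply (is_derive_minus (V := R_NormedModule));
        [| apply (is_derive_scal H)].
      + apply HF; lra.
      + apply HH; lra.
    - intros t Ht. specialize (Hbd t Ht). lra.
    - replace (Finite 0) with (Finite (0 - (l + eps) * 0)) by (f_equal; ring).
      apply is_lim_minus'; [assumption |].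
      apply (is_lim_scal_l H (l + eps) p_infty 0 LH). }
  specialize (Hpos x ltac:(lra)).
  apply Rabs_le.
  replace (F x / H x - l) with ((F x - l * H x) / H x) by (field; lra).
  split; [apply Rle_div_r | apply Rle_div_l]; lra.
Qed.

Lemma is_derive_zero_eq (F : R -> R) (M : R) :
  (forall x, M < x -> is_derive F x 0) ->
  forall x y, M < x -> M < y -> F x = F y.
Proof.
  intros HF.
  assert (Hle : forall x y, M < x -> x <= y -> F x = F y).
  { intros x y Hx Hxy. apply Rle_antisym.
    - apply (nondecreasing_of_derive F (fun _ => 0)); [assumption | |];
        intros t Ht; [apply HF |]; lra.
    - apply Ropp_le_cancel.
      apply (nondecreasing_of_derive (fun t => - F t) (fun _ => - 0));
        [assumption | |]; intros t Ht; [| lra].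
      apply (is_derive_opp F), HF. lra. }
  intros x y Hx Hy. destruct (Rle_or_lt x y) as [H | H].
  - now apply Hle.
  - symmetry. apply Hle; lra.
Qed.

Lemma eventually_constant_lim (F : R -> R) (M c l : R) :
  (forall x, M < x -> F x = c) -> is_lim F p_infty l -> c = l.
Proof.
  intros HF Hl.
  assert (Hc : is_lim F p_infty c).
  { apply is_lim_p_infty_ext with (M := M) (F := fun _ => c);
      [intros x Hx; symmetry; now apply HF | apply is_lim_const]. }
  apply is_lim_unique in Hl, Hc. rewrite Hl in Hc. now injection Hc.
Qed.

Lemma rolle (F dF : R -> R) (a b : R) :
  a < b ->
  (forall x, is_derive F x (dF x)) -> F a = 0 -> F b = 0 ->
  exists c, a < c < b /\ dF c = 0.
Proof.
  intros Hab HF Fa Fb.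
  destruct (MVT_cor2 F dF a b Hab) as (c & Hc & Hcab).
  - intros c _. now apply is_derive_Reals.
  - exists c. split; [assumption |]. rewrite Fa, Fb in Hc.
    destruct (Rmult_integral (dF c) (b - a)); lra.
Qed.

Lemma exp_nondecreasing x y : x <= y -> exp x <= exp y.
Proof.
  intros [H | ->]; [now apply Rlt_le, exp_increasing | apply Rle_refl].
Qed.

Lemma one_le_exp_sq x c : 0 < c -> 1 <= exp (x ^ 2 / c).
Proof.
  intros Hc. rewrite <- exp_0. apply exp_nondecreasing.
  apply Rdiv_le_0_compat; [apply pow2_ge_0 | assumption].
Qed.

(** * The asymptotic scale *)

(** The comparison function in the asymptotics of D_p. *)
Definition weber_scale (p x : R) : R := Rpower x p * exp (- (x ^ 2 / 4)).

Lemma weber_scale_pos p x : 0 < weber_scale p x.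
Proof. apply Rmult_lt_0_compat; apply exp_pos. Qed.

Lemma weber_scale_shift p x :
  0 < x -> weber_scale (p + 1) x = x * weber_scale p x.
Proof.
  intros Hx. unfold weber_scale.
  rewrite Rpower_plus, Rpower_1 by assumption. ring.
Qed.

Lemma weber_scale_0 x : 0 < x -> weber_scale 0 x = exp (- (x ^ 2 / 4)).
Proof. intros Hx. unfold weber_scale. rewrite Rpower_O by assumption. ring. Qed.

Lemma weber_scale_derive p x :
  0 < x ->
  is_derive (weber_scale p) x ((p / x - x / 2) * weber_scale p x).
Proof.
  intros Hx. unfold weber_scale, Rpower.
  auto_derive; [assumption |].
  change (x ^ 2 / 4) with (x * (x * 1) * / 4). field. lra.
Qed.

(** Since ln x <= x, the exponent p ln x - x^2/4 is at most - x as soon as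
    x >= 4 (|p| + 1). *)
Lemma is_lim_weber_scale p : is_lim (weber_scale p) p_infty 0.
Proof.
  apply eps_is_lim_p_infty. intros eps Heps.
  exists (Rmax 4 (Rmax (4 * (Rabs p + 1)) (/ eps))). intros x Hx.
  pose proof (Rmax_l 4 (Rmax (4 * (Rabs p + 1)) (/ eps))).
  pose proof (Rmax_r 4 (Rmax (4 * (Rabs p + 1)) (/ eps))).
  pose proof (Rmax_l (4 * (Rabs p + 1)) (/ eps)).
  pose proof (Rmax_r (4 * (Rabs p + 1)) (/ eps)).
  rewrite Rminus_0_r, Rabs_pos_eq by (apply Rlt_le, weber_scale_pos).
  assert (Hln : 0 <= ln x <= x).
  { split.
    - rewrite <- ln_1. apply ln_le; lra.
    - pose proof (exp_ineq1_le (ln x)) as He. rewrite exp_ln in He by lra. lra. }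
  assert (Hp : p * ln x <= Rabs p * x).
  { pose proof (Rle_abs p). pose proof (Rabs_pos p). nra. }
  assert (Hexp : weber_scale p x <= exp (- x)).
  { unfold weber_scale, Rpower. rewrite <- exp_plus. apply exp_nondecreasing.
    nra. }
  apply Rle_trans with (1 := Hexp). rewrite exp_Ropp.
  assert (Hinv : 0 < / eps) by now apply Rinv_0_lt_compat.
  pose proof (exp_ineq1_le x).
  rewrite <- (Rinv_inv eps). apply Rinv_le_contravar; lra.
Qed.

(** * Asymptotics of the lowered solution *)

(** A solution together with its derivative; this avoids a total derivation
    operator in the computations. *)
Definition weber_pair (mu : R) (f f' : R -> R) : Prop :=
  (forall x, is_derive f x (f' x)) /\
  (forall x, is_derive f' x ((x ^ 2 / 4 - mu - 1 / 2) * f x)).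

Lemma parabolic_cylinder_weber_pair mu f :
  is_parabolic_cylinder mu f -> weber_pair mu f (Derive f).
Proof.
  intros (H1 & H2 & H3 & _). split; intros x.
  - now apply Derive_correct.
  - specialize (H3 x). replace ((x ^ 2 / 4 - mu - 1 / 2) * f x)
      with (Derive (Derive f) x) by lra.
    now apply Derive_correct.
Qed.

Lemma weber_pair_parabolic_cylinder mu f f' :
  weber_pair mu f f' ->
  is_lim (fun x => f x / weber_scale mu x) p_infty 1 ->
  is_parabolic_cylinder mu f.
Proof.
  intros [Hf Hf'] Hlim.
  assert (HD : forall x, Derive f x = f' x)
    by (intros x; now apply is_derive_unique).
  assert (HDD : forall x, is_derive (Derive f) x ((x ^ 2 / 4 - mu - 1 / 2) * f x)).
  { intros x. apply is_derive_ext with f'; [now intros t; rewrite HD | apply Hf']. }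
  repeat split.
  - intros x. now exists (f' x).
  - intros x. eexists. apply HDD.
  - intros x. rewrite (is_derive_unique _ _ _ (HDD x)). ring.
  - exact Hlim.
Qed.

(** The lowering operator: it sends D_mu to mu D_(mu-1). *)
Definition lowered (f f' : R -> R) (x : R) : R := f' x + x / 2 * f x.

Section Asymptotics.
Variables (mu : R) (f f' : R -> R).
Hypothesis Hmu : 0 < mu.
Hypothesis Hf : weber_pair mu f f'.
Hypothesis Hlim : is_lim (fun x => f x / weber_scale mu x) p_infty 1.

Lemma lowered_derive x :
  is_derive (lowered f f') x (x / 2 * lowered f f' x - mu * f x).
Proof.
  destruct Hf as [H0 H1]. unfold lowered.
  auto_derive.
  - repeat split; [eexists; apply H1 | eexists; apply H0].
  - rewrite (is_derive_unique (fun t : R => f t) _ _ (H0 x)),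
      (is_derive_unique (fun t : R => f' t) _ _ (H1 x)). field.
Qed.

Lemma lowered_gauss_derive x :
  is_derive (fun t => lowered f f' t * exp (- (t ^ 2 / 4))) x
    (- mu * f x * exp (- (x ^ 2 / 4))).
Proof.
  pose proof (lowered_derive x) as H.
  auto_derive.
  - eexists; apply H.
  - rewrite (is_derive_unique (fun t : R => lowered f f' t) _ _ H).
    change (x ^ 2 / 4) with (x * (x * 1) * / 4). field.
Qed.

Lemma gauss_conjugate_derive x :
  is_derive (fun t => f t * exp (t ^ 2 / 4)) x
    (lowered f f' x * exp (- (x ^ 2 / 4)) * exp (x ^ 2 / 2)).
Proof.
  destruct Hf as [H0 H1].
  replace (lowered f f' x * exp (- (x ^ 2 / 4)) * exp (x ^ 2 / 2))
    with (lowered f f' x * exp (x ^ 2 / 4)).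
  2:{ rewrite Rmult_assoc, <- exp_plus. do 2 f_equal. field. }
  unfold lowered. auto_derive.
  - eexists; apply H0.
  - rewrite (is_derive_unique (fun t : R => f t) _ _ (H0 x)).
    change (x ^ 2 / 4) with (x * (x * 1) * / 4). field.
Qed.

Lemma eventually_between_0_and_twice_scale :
  exists M, 0 < M /\ forall x, M < x -> 0 < f x < 2 * weber_scale mu x.
Proof.
  destruct (is_lim_p_infty_eps _ _ Hlim 1 Rlt_0_1) as [M HM].
  exists (Rmax M 1). split; [pose proof (Rmax_r M 1); lra |].
  intros x Hx. pose proof (Rmax_l M 1).
  specialize (HM x ltac:(lra)). apply Rabs_def2 in HM.
  pose proof (weber_scale_pos mu x) as Hs.
  replace (f x) with (f x / weber_scale mu x * weber_scale mu x) by (field; lra).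
  nra.
Qed.

(** Let G be the function below.  It is nonincreasing because f > 0, and
    (f exp (t^2/4))' = G exp (t^2/2).  If G were negative somewhere,
    f exp (t^2/4) would lie below a line of negative slope and reach 0. *)
Lemma lowered_gauss_nonneg M :
  (forall x, M < x -> 0 < f x) ->
  forall x, M < x -> 0 <= lowered f f' x * exp (- (x ^ 2 / 4)).
Proof.
  intros HM x0 Hx0.
  set (G := fun t => lowered f f' t * exp (- (t ^ 2 / 4))).
  set (Phi := fun t => f t * exp (t ^ 2 / 4)).
  change (0 <= G x0).
  destruct (Rle_or_lt 0 (G x0)) as [H | H]; [assumption | exfalso].
  assert (HG : forall x, x0 <= x -> G x <= G x0).
  { intros x Hx. apply Ropp_le_cancel.
    apply (nondecreasing_of_derive (fun t => - G t)
             (fun t => - (- mu * f t * exp (- (t ^ 2 / 4))))); [assumption | |].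
    - intros t Ht. apply (is_derive_opp G), lowered_gauss_derive.
    - intros t Ht. specialize (HM t ltac:(lra)).
      pose proof (exp_pos (- (t ^ 2 / 4))).
      assert (0 < mu * f t * exp (- (t ^ 2 / 4)))
        by (apply Rmult_lt_0_compat; [nra | assumption]). lra. }
  assert (HPhi : forall t, M < t -> 0 < Phi t).
  { intros t Ht. apply Rmult_lt_0_compat; [now apply HM | apply exp_pos]. }
  (* The line through (x0, Phi x0) of slope G x0 vanishes at x1. *)
  set (x1 := x0 + Phi x0 / - G x0).
  assert (H0 : 0 < Phi x0 / - G x0)
    by (apply Rdiv_lt_0_compat; [now apply HPhi | lra]).
  assert (Hx1 : x0 < x1) by (unfold x1; lra).
  assert (Hdec : G x0 * x0 - Phi x0 <= G x0 * x1 - Phi x1).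
  { apply (nondecreasing_of_derive (fun t => G x0 * t - Phi t)
             (fun t => G x0 * 1 - G t * exp (t ^ 2 / 2))); [lra | |].
    - intros t Ht. apply (is_derive_minus (V := R_NormedModule)).
      + apply (is_derive_scal (fun t => t)), (is_derive_id (K := R_AbsRing)).
      + apply gauss_conjugate_derive.
    - intros t Ht. specialize (HG t ltac:(lra)).
      pose proof (one_le_exp_sq t 2 ltac:(lra)). nra. }
  specialize (HPhi x1 ltac:(lra)).
  assert (G x0 * (x1 - x0) = - Phi x0) by (unfold x1; field; lra).
  lra.
Qed.

(** A lower bound eps for this function would make f exp (t^2/4) grow at least like
    eps exp (t^2/2), hence faster than x^(mu+1), whereas it stays below
    2 x^mu.  This is where the growing solutions of the equation are
    excluded. *)
Lemma lowered_gauss_frequently_small M eps :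
  0 < eps -> exists x, M < x /\ lowered f f' x * exp (- (x ^ 2 / 4)) < eps.
Proof.
  intros Heps.
  destruct (classic (exists x, M < x /\ lowered f f' x * exp (- (x ^ 2 / 4)) < eps))
    as [H | H]; [assumption | exfalso].
  destruct eventually_between_0_and_twice_scale as (M1 & HM1 & Hclose).
  destruct (is_lim_p_infty_eps _ _ (is_lim_weber_scale mu) (eps / (mu + 1)))
    as [M2 HM2]; [apply Rdiv_lt_0_compat; lra |].
  set (V := fun x => Rpower x (mu + 1)).
  set (Phi := fun t => f t * exp (t ^ 2 / 4)).
  set (x0 := Rmax M (Rmax M1 M2) + 1).
  assert (Hx0 : M < x0 /\ M1 < x0 /\ M2 < x0).
  { unfold x0. pose proof (Rmax_l M (Rmax M1 M2)). pose proof (Rmax_r M (Rmax M1 M2)).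
    pose proof (Rmax_l M1 M2). pose proof (Rmax_r M1 M2). lra. }
  assert (Hgrow : forall x, x0 <= x -> Phi x0 - V x0 <= Phi x - V x).
  { intros x Hx.
    apply (nondecreasing_of_derive (fun t => Phi t - V t)
             (fun t => lowered f f' t * exp (- (t ^ 2 / 4)) * exp (t ^ 2 / 2)
                       - (mu + 1) * Rpower t mu)); [assumption | |].
    - intros t Ht. apply (is_derive_minus (V := R_NormedModule)).
      + apply gauss_conjugate_derive.
      + apply is_derive_Reals.
        pose proof (derivable_pt_lim_power t (mu + 1) ltac:(lra)) as Hpw.
        now replace (mu + 1 - 1) with mu in Hpw by ring.
    - intros t Ht.
      assert (Hge : eps <= lowered f f' t * exp (- (t ^ 2 / 4))).
      { destruct (Rle_or_lt eps (lowered f f' t * exp (- (t ^ 2 / 4)))) as [|Hlt];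
          [assumption | exfalso]. apply H. exists t. split; [lra | assumption]. }
      specialize (HM2 t ltac:(lra)).
      rewrite Rminus_0_r, Rabs_pos_eq in HM2 by (apply Rlt_le, weber_scale_pos).
      assert (Hpow : Rpower t mu = weber_scale mu t * exp (t ^ 2 / 4)).
      { unfold weber_scale. rewrite Rmult_assoc, <- exp_plus.
        replace (- (t ^ 2 / 4) + t ^ 2 / 4) with 0 by ring.
        rewrite exp_0. ring. }
      assert (Hexp : exp (t ^ 2 / 4) <= exp (t ^ 2 / 2)).
      { apply exp_nondecreasing. pose proof (pow2_ge_0 t). lra. }
      apply (Rmult_lt_compat_l (mu + 1)) in HM2; [| lra].
      replace ((mu + 1) * (eps / (mu + 1))) with eps in HM2 by (field; lra).
      rewrite Hpow. pose proof (exp_pos (t ^ 2 / 4)).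
      apply Rle_trans with (eps * exp (t ^ 2 / 2) - eps * exp (t ^ 2 / 4)); nra. }
  (* From x0 on, x^(mu+1) - C <= 2 x^mu; this fails as soon as x >= 3 + |C|. *)
  set (C := V x0 - Phi x0).
  set (x := Rmax x0 (3 + Rabs C)).
  assert (Hx : x0 <= x /\ 3 + Rabs C <= x) by (split; [apply Rmax_l | apply Rmax_r]).
  specialize (Hgrow x (proj1 Hx)). fold C in Hgrow.
  specialize (Hclose x ltac:(lra)).
  assert (HPhi : Phi x <= 2 * Rpower x mu).
  { unfold Phi. apply Rle_trans with (2 * weber_scale mu x * exp (x ^ 2 / 4)).
    - apply Rmult_le_compat_r; [apply Rlt_le, exp_pos | lra].
    - unfold weber_scale. rewrite !Rmult_assoc, <- exp_plus.
      replace (- (x ^ 2 / 4) + x ^ 2 / 4) with 0 by ring.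
      rewrite exp_0. lra. }
  assert (HV : V x = x * Rpower x mu).
  { unfold V. rewrite Rpower_plus, Rpower_1 by lra. ring. }
  pose proof (Rabs_pos C). pose proof (Rle_abs C).
  assert (Hge1 : 1 <= Rpower x mu).
  { rewrite <- (Rpower_O x) by lra. apply Rle_Rpower; lra. }
  assert (Phi x0 - V x0 = - C) by (unfold C; ring).
  nra.
Qed.

Lemma is_lim_lowered_gauss :
  is_lim (fun x => lowered f f' x * exp (- (x ^ 2 / 4))) p_infty 0.
Proof.
  destruct eventually_between_0_and_twice_scale as (M & HM & Hclose).
  apply eps_is_lim_p_infty. intros eps Heps.
  destruct (lowered_gauss_frequently_small M eps Heps) as (x0 & Hx0 & Hsmall).
  exists x0. intros x Hx. rewrite Rminus_0_r, Rabs_pos_eq.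
  2:{ apply (lowered_gauss_nonneg M); [apply Hclose | lra]. }
  apply Rlt_le, Rle_lt_trans with (2 := Hsmall). apply Ropp_le_cancel.
  apply (nondecreasing_of_derive
           (fun t => - (lowered f f' t * exp (- (t ^ 2 / 4))))
           (fun t => - (- mu * f t * exp (- (t ^ 2 / 4))))); [lra | |].
  - intros t Ht.
    apply (is_derive_opp (fun t => lowered f f' t * exp (- (t ^ 2 / 4)))),
      lowered_gauss_derive.
  - intros t Ht. destruct (Hclose t ltac:(lra)) as [Hpos _].
    pose proof (exp_pos (- (t ^ 2 / 4))).
    assert (0 < mu * f t * exp (- (t ^ 2 / 4)))
      by (apply Rmult_lt_0_compat; [nra | assumption]). lra.
Qed.

(** L'Hopital's rule for the quotient of (f' + x f / 2) exp (-x^2/4) by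
    x^(mu-1) exp (-x^2/2): the quotient of the derivatives is
    mu f / (x^mu exp (-x^2/4)) up to a factor tending to 1. *)
Lemma is_lim_lowered_scale :
  is_lim (fun x => lowered f f' x / weber_scale (mu - 1) x) p_infty mu.
Proof.
  (* Beyond M the derivative of the denominator is negative. *)
  set (M := Rabs mu + 1).
  assert (HM : 1 <= M /\ mu < M).
  { unfold M. pose proof (Rabs_pos mu). pose proof (Rle_abs mu). lra. }
  set (w := fun x => weber_scale (mu - 1) x).
  apply is_lim_p_infty_ext with (M := 0)
    (F := fun x => (lowered f f' x * exp (- (x ^ 2 / 4)))
                   / (w x * weber_scale 0 x)).
  { intros x Hx. unfold w. rewrite <- (weber_scale_0 x Hx).
    pose proof (weber_scale_pos (mu - 1) x).
    pose proof (weber_scale_pos 0 x). field. lra. }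
  apply lhopital_p_infty with (M := M)
    (dF := fun x => - mu * f x * exp (- (x ^ 2 / 4)))
    (dH := fun x => ((mu - 1) / x - x) * (w x * weber_scale 0 x)).
  - intros x Hx. apply lowered_gauss_derive.
  - intros x Hx.
    pose proof (weber_scale_derive (mu - 1) x ltac:(lra)) as D1.
    pose proof (weber_scale_derive 0 x ltac:(lra)) as D0.
    unfold w. auto_derive.
    + repeat split; eexists; [apply D1 | apply D0].
    + rewrite (is_derive_unique (fun t : R => weber_scale (mu - 1) t) _ _ D1),
        (is_derive_unique (fun t : R => weber_scale 0 t) _ _ D0).
      field. lra.
  - intros x Hx. apply Rmult_lt_0_compat; apply weber_scale_pos.
  - intros x Hx.
    assert (0 < w x * weber_scale 0 x)
      by (apply Rmult_lt_0_compat; apply weber_scale_pos).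
    assert ((mu - 1) / x - x < 0); [| nra].
    apply Rlt_minus. apply Rlt_div_l; nra.
  - apply is_lim_lowered_gauss.
  - replace (Finite 0) with (Finite (0 * 0)) by (f_equal; ring).
    apply is_lim_mult_finite; apply is_lim_weber_scale.
  - apply is_lim_p_infty_ext with (M := M)
      (F := fun x => mu * (f x / weber_scale mu x) / (1 - (mu - 1) * / x ^ 2)).
    { intros x Hx. pose proof (weber_scale_0 x ltac:(lra)) as E. rewrite E.
      replace mu with (mu - 1 + 1) at 2 by ring.
      rewrite weber_scale_shift by lra. fold (w x).
      assert (0 < w x) by apply weber_scale_pos.
      pose proof (weber_scale_pos 0 x).
      assert (mu - 1 - x ^ 2 < 0) by nra.
      field. repeat split; try lra; nra. }
    replace (Finite mu) with (Finite (mu * 1 / (1 - (mu - 1) * 0)))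
      by (f_equal; field; lra).
    apply is_lim_div_finite; [lra | |].
    + apply (is_lim_scal_l _ mu p_infty 1 Hlim).
    + apply is_lim_minus'; [apply is_lim_const |].
      apply (is_lim_scal_l _ (mu - 1) p_infty 0 is_lim_inv_sq).
Qed.
End Asymptotics.

(** * Ladder relations and uniqueness *)

(** With g = f' + x f / 2, the equation gives g' = x g / 2 - mu f; one more
    derivation yields the equation of parameter mu - 1. *)
Lemma lowered_is_parabolic_cylinder mu f :
  0 < mu -> is_parabolic_cylinder mu f ->
  is_parabolic_cylinder (mu - 1) (fun x => lowered f (Derive f) x / mu).
Proof.
  intros Hmu Hf.
  pose proof (parabolic_cylinder_weber_pair mu f Hf) as Hp.
  destruct Hf as (_ & _ & _ & Hlim).
  pose proof (fun x => lowered_derive mu f _ Hp x) as Hg.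
  set (g := lowered f (Derive f)) in *.
  apply weber_pair_parabolic_cylinder
    with (fun x => (x / 2 * g x - mu * f x) / mu).
  - split; intros x.
    + auto_derive; [eexists; apply Hg |].
      rewrite (is_derive_unique (fun t : R => g t) _ _ (Hg x)). field. lra.
    + destruct Hp as [H0 _].
      auto_derive; [repeat split; eexists; [apply Hg | apply H0] |].
      rewrite (is_derive_unique (fun t : R => g t) _ _ (Hg x)),
        (is_derive_unique (fun t : R => f t) _ _ (H0 x)).
      unfold g, lowered. field. lra.
  - replace (Finite 1) with (Finite (mu / mu)) by (f_equal; field; lra).
    apply is_lim_p_infty_ext with (M := 0)
      (F := fun x => g x / weber_scale (mu - 1) x / mu).
    + intros x _. pose proof (weber_scale_pos (mu - 1) x). field. lra.
    + apply is_lim_div_finite; [lra | | apply is_lim_const].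
      apply is_lim_lowered_scale; assumption.
Qed.

(** x f / 2 - f' = x f - (f' + x f / 2), and the second term is smaller than the
    first by a factor of order x^(-2), so the asymptotics of f prevail. *)
Lemma raised_is_parabolic_cylinder mu f :
  0 < mu -> is_parabolic_cylinder mu f ->
  is_parabolic_cylinder (mu + 1) (fun x => x / 2 * f x - Derive f x).
Proof.
  intros Hmu Hf.
  pose proof (parabolic_cylinder_weber_pair mu f Hf) as Hp.
  destruct Hf as (_ & _ & _ & Hlim).
  pose proof (is_lim_lowered_scale mu f _ Hmu Hp Hlim) as Hlow.
  destruct Hp as [H0 H1].
  set (p := Derive f) in *.
  apply weber_pair_parabolic_cylinder
    with (fun x => (mu + 1) * f x - x / 2 * (x / 2 * f x - p x)).
  - split; intros x.
    + auto_derive; [repeat split; eexists; [apply H0 | apply H1] |].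
      rewrite (is_derive_unique (fun t : R => f t) _ _ (H0 x)),
        (is_derive_unique (fun t : R => p t) _ _ (H1 x)). field.
    + auto_derive; [repeat split; eexists; first [apply H0 | apply H1] |].
      rewrite (is_derive_unique (fun t : R => f t) _ _ (H0 x)),
        (is_derive_unique (fun t : R => p t) _ _ (H1 x)). field.
  - replace (Finite 1) with (Finite (1 - mu * 0)) by (f_equal; ring).
    apply is_lim_p_infty_ext with (M := 0)
      (F := fun x => f x / weber_scale mu x
                     - lowered f p x / weber_scale (mu - 1) x * / x ^ 2).
    + intros x Hx. rewrite weber_scale_shift by assumption.
      replace mu with (mu - 1 + 1) at 1 3 by ring.
      rewrite weber_scale_shift by assumption.
      pose proof (weber_scale_pos (mu - 1) x).
      unfold lowered. field. split; lra.
    + apply is_lim_minus'; [exact Hlim |].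
      apply is_lim_mult_finite; [exact Hlow | apply is_lim_inv_sq].
Qed.

(** Gronwall's argument: on [x, x0] the energy u^2 + u'^2 has derivative
    2 (1 + q) u u' >= - K (u^2 + u'^2), with q the coefficient of the equation;
    so exp (K t) (u^2 + u'^2) is nondecreasing, and it vanishes at x0. *)
Lemma weber_pair_zero_backward mu u u' x0 :
  weber_pair mu u u' -> u x0 = 0 -> u' x0 = 0 ->
  forall x, x <= x0 -> u x = 0.
Proof.
  intros [Hu Hu'] Hz Hz' x Hx.
  set (K := Rabs mu + 2 + (x ^ 2 + x0 ^ 2) / 4).
  assert (Hmono : exp (K * x) * (u x ^ 2 + u' x ^ 2)
                  <= exp (K * x0) * (u x0 ^ 2 + u' x0 ^ 2)).
  { apply (nondecreasing_of_derive (fun t => exp (K * t) * (u t ^ 2 + u' t ^ 2))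
      (fun t => exp (K * t) * (K * (u t ^ 2 + u' t ^ 2)
                + 2 * (1 + (t ^ 2 / 4 - mu - 1 / 2)) * (u t * u' t))));
      [assumption | |].
    - intros t _. auto_derive; [repeat split; eexists; [apply Hu | apply Hu'] |].
      rewrite (is_derive_unique (fun t : R => u t) _ _ (Hu t)),
        (is_derive_unique (fun t : R => u' t) _ _ (Hu' t)). field.
    - intros t Ht. apply Rmult_le_pos; [apply Rlt_le, exp_pos |].
      set (q := 1 + (t ^ 2 / 4 - mu - 1 / 2)).
      assert (Ht2 : 0 <= t ^ 2 <= x ^ 2 + x0 ^ 2).
      { split; [apply pow2_ge_0 |].
        destruct (Rle_or_lt 0 t); nra. }
      assert (Hq : - K <= q <= K).
      { unfold q, K. pose proof (Rle_abs mu). pose proof (Rle_abs (- mu)) as Hn.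
        rewrite Rabs_Ropp in Hn. lra. }
      assert (0 <= (K + q) * (u t + u' t) ^ 2)
        by (apply Rmult_le_pos; [lra | apply pow2_ge_0]).
      assert (0 <= (K - q) * (u t - u' t) ^ 2)
        by (apply Rmult_le_pos; [lra | apply pow2_ge_0]).
      lra. }
  rewrite Hz, Hz' in Hmono.
  pose proof (exp_pos (K * x)). pose proof (pow2_ge_0 (u x)).
  pose proof (pow2_ge_0 (u' x)).
  assert (u x ^ 2 <= 0) by nra. nra.
Qed.

(** The Wronskian W is constant and, by the asymptotics of the lowered
    functions, of order x^(2 mu - 1) exp (-x^2/2); so W = 0.  Near +oo, where f1
    does not vanish, f2 / f1 is then constant, equal to its limit 1, and the
    equality propagates to the whole line. *)
Lemma parabolic_cylinder_unique mu f1 f2 :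
  0 < mu -> is_parabolic_cylinder mu f1 -> is_parabolic_cylinder mu f2 ->
  forall x, f1 x = f2 x.
Proof.
  intros Hmu Hf1 Hf2.
  pose proof (parabolic_cylinder_weber_pair mu f1 Hf1) as P1.
  pose proof (parabolic_cylinder_weber_pair mu f2 Hf2) as P2.
  destruct Hf1 as (_ & _ & _ & L1), Hf2 as (_ & _ & _ & L2).
  pose proof (is_lim_lowered_scale mu f1 _ Hmu P1 L1) as G1.
  pose proof (is_lim_lowered_scale mu f2 _ Hmu P2 L2) as G2.
  destruct (eventually_between_0_and_twice_scale mu f1 L1) as (M & HM & Hclose).
  set (p1 := Derive f1) in *. set (p2 := Derive f2) in *.
  clearbody p1 p2.
  destruct P1 as [A1 B1], P2 as [A2 B2].
  set (W := fun x => f1 x * p2 x - f2 x * p1 x).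
  assert (HW' : forall x, is_derive W x 0).
  { intros x. unfold W. auto_derive.
    - repeat split; eexists; [apply A1 | apply B2 | apply A2 | apply B1].
    - rewrite (is_derive_unique (fun t : R => f1 t) _ _ (A1 x)),
        (is_derive_unique (fun t : R => f2 t) _ _ (A2 x)),
        (is_derive_unique (fun t : R => p1 t) _ _ (B1 x)),
        (is_derive_unique (fun t : R => p2 t) _ _ (B2 x)). ring. }
  assert (HWlim : is_lim W p_infty 0).
  { replace (Finite 0) with (Finite ((1 * mu - 1 * mu) * (0 * 0)))
      by (f_equal; ring).
    apply is_lim_p_infty_ext with (M := M)
      (F := fun x => (f1 x / weber_scale mu x
                        * (lowered f2 p2 x / weber_scale (mu - 1) x)
                      - f2 x / weber_scale mu x
                        * (lowered f1 p1 x / weber_scale (mu - 1) x))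
                     * (weber_scale mu x * weber_scale (mu - 1) x)).
    - intros x _. pose proof (weber_scale_pos mu x).
      pose proof (weber_scale_pos (mu - 1) x).
      unfold W, lowered. field. lra.
    - apply is_lim_mult_finite.
      + apply is_lim_minus'; now apply is_lim_mult_finite.
      + apply is_lim_mult_finite; apply is_lim_weber_scale. }
  assert (HW0 : forall x, M < x -> W x = 0).
  { intros x Hx. apply (eventually_constant_lim W M); [| assumption].
    intros y Hy. apply (is_derive_zero_eq W M); auto. }
  assert (Hratio : forall x, M < x -> f2 x / f1 x = 1).
  { intros x Hx. apply (eventually_constant_lim (fun t => f2 t / f1 t) M).
    - intros y Hy. apply (is_derive_zero_eq (fun t => f2 t / f1 t) M); auto.
      intros t Ht. pose proof (proj1 (Hclose t Ht)).
      auto_derive.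
      + repeat split; [eexists; apply A2 | eexists; apply A1 | lra].
      + rewrite (is_derive_unique (fun t : R => f1 t) _ _ (A1 t)),
          (is_derive_unique (fun t : R => f2 t) _ _ (A2 t)).
        transitivity (W t / f1 t ^ 2); [unfold W; field; lra |].
        rewrite HW0 by assumption. field. lra.
    - replace (Finite 1) with (Finite (1 / 1)) by (f_equal; field).
      apply is_lim_p_infty_ext with (M := M)
        (F := fun t => f2 t / weber_scale mu t / (f1 t / weber_scale mu t)).
      + intros t Ht. pose proof (proj1 (Hclose t Ht)).
        pose proof (weber_scale_pos mu t). field. lra.
      + apply is_lim_div_finite; [lra | assumption | assumption]. }
  assert (Heq : forall x, M < x -> f1 x = f2 x /\ p1 x = p2 x).
  { intros x Hx. pose proof (proj1 (Hclose x Hx)) as Hpos.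
    specialize (Hratio x Hx). specialize (HW0 x Hx).
    assert (E : f2 x = f1 x)
      by (replace (f2 x) with (f2 x / f1 x * f1 x) by (field; lra);
          rewrite Hratio; ring).
    split; [now symmetry |]. unfold W in HW0. rewrite E in HW0. nra. }
  intros x. set (x0 := Rmax x (M + 1)).
  assert (Hx0 : M < x0 /\ x <= x0).
  { unfold x0. pose proof (Rmax_l x (M + 1)). pose proof (Rmax_r x (M + 1)). lra. }
  destruct (Heq x0 (proj1 Hx0)) as [E E'].
  apply Rminus_diag_uniq.
  apply (weber_pair_zero_backward mu (fun t => f1 t - f2 t)
           (fun t => p1 t - p2 t) x0); [| lra | lra | tauto].
  split; intros t.
  - now apply (is_derive_minus (V := R_NormedModule)).
  - replace ((t ^ 2 / 4 - mu - 1 / 2) * (f1 t - f2 t))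
      with ((t ^ 2 / 4 - mu - 1 / 2) * f1 t - (t ^ 2 / 4 - mu - 1 / 2) * f2 t)
      by ring.
    now apply (is_derive_minus (V := R_NormedModule)).
Qed.

(** * The quotient between two consecutive zeros *)

(** nu times the function Pi_nu, expressed by the logarithmic derivative. *)
Definition scaled_turan (nu : R) (f f' : R -> R) (x : R) : R :=
  nu - x ^ 2 / 4 + (f' x / f x) ^ 2.

(** The derivative of [scaled_turan] multiplied by f^2.  The weight f^2 is an
    integrating factor: it removes the term - 2 h K' from
    K'' = 2 K (K + 1) - 2 h K' and leaves a derivative of constant sign. *)
Definition turan_slope (nu : R) (f f' : R -> R) (x : R) : R :=
  - (x / 2) * f x ^ 2 - f x * f' x * (2 * scaled_turan nu f f' x + 1).

Section ConsecutiveZeros.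
Variables (nu : R) (f f' : R -> R) (a b : R).
Hypothesis Hnu : 0 < nu.
Hypothesis Hf : weber_pair nu f f'.
Hypothesis Ha : 0 < a.
Hypothesis Hab : a < b.
Hypothesis Hfa : f a = 0.
Hypothesis Hfb : f b = 0.
Hypothesis Hf0 : forall x, a < x < b -> f x <> 0.

(** Let m be a minimum point on [a, b] of T = f^2 K, which is continuous across
    the zeros of f.  If T is nonpositive at x, either m or x itself is an
    interior minimum point c with T c <= 0.  There T' = - f (f' + c f / 2)
    vanishes, which forces f' = - c f / 2 and T c = nu f^2 > 0. *)
Lemma turan_positive x : a < x < b -> 0 < scaled_turan nu f f' x.
Proof.
  intros Hx. destruct Hf as [H0 H1].
  set (T := fun t => (nu - t ^ 2 / 4) * f t ^ 2 + f' t ^ 2).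
  assert (HT : forall t, is_derive T t (- (f t * lowered f f' t))).
  { intros t. unfold T, lowered.
    auto_derive; [repeat split; eexists; [apply H0 | apply H1] |].
    rewrite (is_derive_unique (fun t : R => f t) _ _ (H0 t)),
      (is_derive_unique (fun t : R => f' t) _ _ (H1 t)). field. }
  assert (Hpos : 0 < T x).
  { destruct (Rlt_or_le 0 (T x)) as [|Hle]; [assumption | exfalso].
    destruct (continuity_ab_min T a b) as (m & Hm & Hmab); [lra | |].
    { intros t _. apply continuity_pt_filterlim, (ex_derive_continuous T t).
      eexists; apply HT. }
    assert (Hc : exists c, a < c < b /\ T c <= 0 /\
                   forall t, a <= t <= b -> T c <= T t).
    { destruct (Rlt_or_le (T m) (T x)) as [Hlt | Hge].
      - exists m. repeat split; try lra; [| | assumption].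
        + destruct (Req_dec m a) as [-> |]; [| lra].
          unfold T in Hlt at 1, Hle. rewrite Hfa in Hlt.
          pose proof (pow2_ge_0 (f' a)). unfold T in *. nra.
        + destruct (Req_dec m b) as [-> |]; [| lra].
          unfold T in Hlt at 1. rewrite Hfb in Hlt.
          pose proof (pow2_ge_0 (f' b)). nra.
      - exists x. repeat split; try lra. intros t Ht.
        apply Rle_trans with (1 := Hge). now apply Hm. }
    destruct Hc as (c & Hc & HTc & Hmin).
    assert (Hcrit : lowered f f' c = 0).
    { assert (Hd : derivable_pt_lim T c (- (f c * lowered f f' c)))
        by now apply is_derive_Reals.
      set (pr := exist _ _ Hd : derivable_pt T c).
      assert (E : derive_pt T c pr = 0).
      { apply (deriv_minimum T a b c pr); try lra. intros t Hta Htb.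
        apply Hmin. lra. }
      change (- (f c * lowered f f' c) = 0) in E.
      specialize (Hf0 c Hc).
      destruct (Rmult_integral (f c) (lowered f f' c)); [lra | contradiction | assumption]. }
    assert (E : f' c = - (c / 2 * f c)) by (unfold lowered in Hcrit; lra).
    unfold T in HTc. rewrite E in HTc.
    assert (0 < f c ^ 2) by (apply pow2_gt_0, Hf0, Hc).
    nra. }
  pose proof (Hf0 x Hx) as Hfx.
  replace (scaled_turan nu f f' x) with (T x / f x ^ 2)
    by (unfold T, scaled_turan; field; assumption).
  apply Rdiv_lt_0_compat; [assumption | now apply pow2_gt_0].
Qed.

Lemma scaled_turan_derive x :
  a < x < b ->
  is_derive (scaled_turan nu f f') x (turan_slope nu f f' x / f x ^ 2).
Proof.
  intros Hx. destruct Hf as [H0 H1]. pose proof (Hf0 x Hx) as Hfx.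
  unfold scaled_turan. auto_derive.
  - repeat split; [eexists; apply H1 | eexists; apply H0 | assumption].
  - rewrite (is_derive_unique (fun t : R => f t) _ _ (H0 x)),
      (is_derive_unique (fun t : R => f' t) _ _ (H1 x)).
    unfold turan_slope, scaled_turan. field. assumption.
Qed.

Lemma turan_slope_derive x :
  a < x < b ->
  is_derive (turan_slope nu f f') x
    (2 * f x ^ 2 * scaled_turan nu f f' x * (scaled_turan nu f f' x + 1)).
Proof.
  intros Hx. pose proof (scaled_turan_derive x Hx) as HK.
  destruct Hf as [H0 H1]. pose proof (Hf0 x Hx) as Hfx.
  unfold turan_slope at 1. auto_derive.
  - repeat split; eexists; first [apply H0 | apply H1 | apply HK].
  - rewrite (is_derive_unique (fun t : R => f t) _ _ (H0 x)),
      (is_derive_unique (fun t : R => f' t) _ _ (H1 x)),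
      (is_derive_unique (fun t : R => scaled_turan nu f f' t) _ _ HK).
    unfold turan_slope, scaled_turan. field. assumption.
Qed.

Lemma turan_slope_increasing x y :
  a < x -> x < y -> y < b -> turan_slope nu f f' x < turan_slope nu f f' y.
Proof.
  intros Hx Hxy Hy.
  apply increasing_of_derive with
    (dF := fun t => 2 * f t ^ 2 * scaled_turan nu f f' t * (scaled_turan nu f f' t + 1)).
  - assumption.
  - intros t Ht. apply turan_slope_derive. lra.
  - intros t Ht. pose proof (turan_positive t ltac:(lra)).
    assert (0 < f t ^ 2) by (apply pow2_gt_0, Hf0; lra).
    apply Rmult_lt_0_compat; [apply Rmult_lt_0_compat |]; lra.
Qed.

(** The slope is negative where f' = 0, and equals x f^2 K > 0 where
    f' = - x f / 2, which is where f exp (x^2/4) has zero derivative.  Rolle's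
    theorem provides both kinds of points. *)
Lemma turan_slope_zero : exists c, a < c < b /\ turan_slope nu f f' c = 0.
Proof.
  destruct (rolle f f' a b) as (p & Hp & Ep); try assumption; [apply Hf |].
  destruct (rolle (fun x => f x * exp (x ^ 2 / 4))
              (fun x => lowered f f' x * exp (- (x ^ 2 / 4)) * exp (x ^ 2 / 2)) a b)
    as (q & Hq & Eq).
  { assumption. }
  { intros x. apply (gauss_conjugate_derive nu f f' Hf). }
  { rewrite Hfa. ring. }
  { rewrite Hfb. ring. }
  assert (Eq' : f' q = - (q / 2 * f q)).
  { pose proof (exp_pos (- (q ^ 2 / 4))). pose proof (exp_pos (q ^ 2 / 2)).
    destruct (Rmult_integral _ _ Eq) as [E | E]; [| lra].
    destruct (Rmult_integral _ _ E) as [E' | E']; [| lra].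
    unfold lowered in E'. lra. }
  assert (Sp : turan_slope nu f f' p < 0).
  { unfold turan_slope. rewrite Ep.
    assert (0 < f p ^ 2) by now apply pow2_gt_0, Hf0. nra. }
  assert (Sq : 0 < turan_slope nu f f' q).
  { pose proof (turan_positive q Hq) as HK. unfold turan_slope. rewrite Eq'.
    assert (0 < f q ^ 2) by now apply pow2_gt_0, Hf0.
    assert (0 < q * (f q ^ 2 * scaled_turan nu f f' q))
      by (apply Rmult_lt_0_compat; [lra | now apply Rmult_lt_0_compat]).
    lra. }
  assert (Hpq : p < q).
  { destruct (Rlt_or_le p q) as [| [H | ->]]; [assumption | |]; [| lra].
    pose proof (turan_slope_increasing q p). lra. }
  destruct (IVT_interv (turan_slope nu f f') p q) as (c & Hc & Ec); try assumption.
  - intros t Ht. apply continuity_pt_filterlim, (ex_derive_continuous (turan_slope nu f f') t).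
    eexists. apply turan_slope_derive. lra.
  - exists c. split; [lra | assumption].
Qed.

Lemma scaled_turan_strict_min c :
  a < c < b -> turan_slope nu f f' c = 0 ->
  forall x, a < x < b -> x <> c -> scaled_turan nu f f' c < scaled_turan nu f f' x.
Proof.
  intros Hc Ec.
  assert (Hq : forall t, a < t < b -> 0 < / f t ^ 2).
  { intros t Ht. now apply Rinv_0_lt_compat, pow2_gt_0, Hf0. }
  assert (Hsl : forall t, a < t < b -> t < c -> turan_slope nu f f' t / f t ^ 2 < 0).
  { intros t Ht Htc. specialize (Hq t Ht).
    pose proof (turan_slope_increasing t c). unfold Rdiv. nra. }
  assert (Hsr : forall t, a < t < b -> c < t -> 0 < turan_slope nu f f' t / f t ^ 2).
  { intros t Ht Htc. specialize (Hq t Ht).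
    pose proof (turan_slope_increasing c t). unfold Rdiv. nra. }
  assert (Hz : turan_slope nu f f' c / f c ^ 2 = 0) by (rewrite Ec; unfold Rdiv; ring).
  intros x Hx Hxc.
  (* The derivative vanishes at c, so strict monotonicity is only available
     between the midpoint and x; from c to the midpoint the weak one is enough. *)
  set (m := (c + x) / 2).
  destruct (Rlt_or_le c x) as [Hlt | Hle].
  - apply Rle_lt_trans with (scaled_turan nu f f' m).
    + apply nondecreasing_of_derive with (fun t => turan_slope nu f f' t / f t ^ 2);
        unfold m; [lra | |]; intros t Ht.
      * apply scaled_turan_derive. lra.
      * destruct (Req_dec t c) as [-> | Hne]; [lra | apply Rlt_le, Hsr; lra].
    + apply increasing_of_derive with (fun t => turan_slope nu f f' t / f t ^ 2);
        unfold m; [lra | |]; intros t Ht.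
      * apply scaled_turan_derive. lra.
      * apply Hsr; lra.
  - apply Ropp_lt_cancel. apply Rlt_le_trans with (- scaled_turan nu f f' m).
    + apply (increasing_of_derive (fun t => - scaled_turan nu f f' t)
               (fun t => - (turan_slope nu f f' t / f t ^ 2)));
        unfold m; [lra | |]; intros t Ht.
      * apply (is_derive_opp (scaled_turan nu f f')), scaled_turan_derive. lra.
      * specialize (Hsl t). lra.
    + apply (nondecreasing_of_derive (fun t => - scaled_turan nu f f' t)
               (fun t => - (turan_slope nu f f' t / f t ^ 2)));
        unfold m; [lra | |]; intros t Ht.
      * apply (is_derive_opp (scaled_turan nu f f')), scaled_turan_derive. lra.
      * destruct (Req_dec t c) as [-> | Hne]; [lra |]. specialize (Hsl t). lra.
Qed.

(** A zero slope means h (2K + 1) = - c / 2; substitute this h into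
    K = nu - c^2/4 + h^2. *)
Lemma critical_value_relation c :
  a < c < b -> turan_slope nu f f' c = 0 ->
  let K := scaled_turan nu f f' c in
  nu = K + c ^ 2 / 4 * (1 - / (2 * K + 1) ^ 2).
Proof.
  intros Hc Ec K. pose proof (turan_positive c Hc) as HK. fold K in HK.
  pose proof (Hf0 c Hc) as Hfc.
  assert (Eh : f' c / f c = - (c / 2) / (2 * K + 1)).
  { unfold turan_slope in Ec. fold K in Ec.
    apply Rmult_eq_reg_r with (f c ^ 2 * (2 * K + 1)).
    - field_simplify; [| lra | lra]. lra.
    - apply Rmult_integral_contrapositive_currified;
        [now apply pow_nonzero | lra]. }
  assert (EK : K = nu - c ^ 2 / 4 + (f' c / f c) ^ 2) by reflexivity.
  rewrite Eh in EK.
  replace nu with (K + c ^ 2 / 4 - (- (c / 2) / (2 * K + 1)) ^ 2) by lra.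
  field. lra.
Qed.
End ConsecutiveZeros.

(** The right-hand side of the relation increases with c and with K > 0, so a
    larger c forces a smaller K. *)
Lemma critical_value_decreasing nu c1 c2 K1 K2 :
  0 < c1 < c2 -> 0 < K1 -> 0 < K2 ->
  nu = K1 + c1 ^ 2 / 4 * (1 - / (2 * K1 + 1) ^ 2) ->
  nu = K2 + c2 ^ 2 / 4 * (1 - / (2 * K2 + 1) ^ 2) ->
  K2 < K1.
Proof.
  intros Hc H1 H2 E1 E2.
  destruct (Rlt_or_le K2 K1) as [| Hle]; [assumption | exfalso].
  assert (Hi : / (2 * K2 + 1) ^ 2 <= / (2 * K1 + 1) ^ 2)
    by (apply Rinv_le_contravar; nra).
  assert (Hi1 : / (2 * K1 + 1) ^ 2 < 1)
    by (rewrite <- Rinv_1; apply Rinv_lt_contravar; nra).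
  assert (Hsq : c1 ^ 2 < c2 ^ 2) by nra.
  assert (0 < c1 ^ 2) by nra.
  set (u := / (2 * K1 + 1) ^ 2) in *. set (v := / (2 * K2 + 1) ^ 2) in *.
  assert (c1 ^ 2 * (1 - u) < c2 ^ 2 * (1 - v)) by nra.
  lra.
Qed.

Lemma critical_value_lt nu c K :
  0 < c -> 0 < K -> nu = K + c ^ 2 / 4 * (1 - / (2 * K + 1) ^ 2) -> K < nu.
Proof.
  intros Hc HK E.
  assert (Hi1 : / (2 * K + 1) ^ 2 < 1)
    by (rewrite <- Rinv_1; apply Rinv_lt_contravar; nra).
  assert (0 < c ^ 2 / 4 * (1 - / (2 * K + 1) ^ 2))
    by (apply Rmult_lt_0_compat; nra).
  lra.
Qed.

(** By uniqueness the two neighbours of D_nu are its lowered and raised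
    functions, and (x f / 2 + f') (x f / 2 - f') = f^2 (x^2/4 - h^2). *)
Lemma Pi_turan_scaled (D : R -> R -> R) nu x :
  (forall mu, is_parabolic_cylinder mu (D mu)) -> 1 < nu -> D nu x <> 0 ->
  Pi_turan D nu x = scaled_turan nu (D nu) (Derive (D nu)) x / nu.
Proof.
  intros HD Hnu Hx. unfold Pi_turan.
  rewrite (parabolic_cylinder_unique (nu - 1) _ _ ltac:(lra) (HD (nu - 1))
             (lowered_is_parabolic_cylinder nu _ ltac:(lra) (HD nu)) x).
  rewrite (parabolic_cylinder_unique (nu + 1) _ _ ltac:(lra) (HD (nu + 1))
             (raised_is_parabolic_cylinder nu _ ltac:(lra) (HD nu)) x).
  unfold lowered, scaled_turan. field. split; [assumption | lra].
Qed.

(** * Consecutive zeros and the final statement *)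

Lemma enumeration_le f N d :
  enumerates_positive_zeros f N d ->
  forall i j, (1 <= i)%nat -> (i <= j)%nat -> (j <= N)%nat -> d i <= d j.
Proof.
  intros (_ & Hd & _) i j Hi Hij. induction Hij as [| j Hij IH]; intros Hj.
  - apply Rle_refl.
  - specialize (Hd j ltac:(lia)). specialize (IH ltac:(lia)). lra.
Qed.

Lemma enumeration_consecutive f N d n :
  enumerates_positive_zeros f N d -> (1 <= n <= N - 1)%nat ->
  forall x, d n < x < d (S n) -> f x <> 0.
Proof.
  intros He Hn x Hx Hfx.
  pose proof (enumeration_le f N d He) as Hle.
  destruct He as (H1 & _ & H3).
  destruct (H1 n ltac:(lia)) as [Hpos _].
  destruct (H3 x ltac:(lra) Hfx) as (m & Hm & ->).
  destruct (Nat.le_gt_cases m n).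
  - specialize (Hle m n). specialize (Hle ltac:(lia) ltac:(lia) ltac:(lia)). lra.
  - specialize (Hle (S n) m ltac:(lia) ltac:(lia) ltac:(lia)). lra.
Qed.

Theorem theorem5 (D : R -> R -> R)
    (HD : forall mu : R, is_parabolic_cylinder mu (D mu))
    (nu : R) (hnu : 3 < nu)
    (N : nat) (d : nat -> R)
    (hd : enumerates_positive_zeros (D nu) N d) :
  exists gamma : nat -> R,
    (forall n : nat, (1 <= n <= N - 1)%nat ->
       d n < gamma n < d (S n) /\
       is_critical_point (Pi_turan D nu) (gamma n) /\
       (forall x : R, d n < x < d (S n) ->
          is_critical_point (Pi_turan D nu) x -> x = gamma n) /\
       is_strict_min_on (Pi_turan D nu) (d n) (d (S n)) (gamma n)) /\
    let delta := fun n : nat => Pi_turan D nu (gamma n) in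
    (forall n : nat, (1 <= n <= N - 1)%nat -> 1 > delta n /\ delta n > 0) /\
    (forall n : nat, (1 <= n)%nat -> (S n <= N - 1)%nat ->
       delta n > delta (S n)) /\
    (forall n : nat, (1 <= n <= N - 1)%nat ->
       (forall x : R, d n < x < d (S n) ->
          (D nu x) ^ 2 - D (nu - 1) x * D (nu + 1) x
            >= delta n * (D nu x) ^ 2) /\
       (forall c : R,
          (forall x : R, d n < x < d (S n) ->
             (D nu x) ^ 2 - D (nu - 1) x * D (nu + 1) x
               >= c * (D nu x) ^ 2) ->
          c <= delta n)).
Proof.
  pose proof (parabolic_cylinder_weber_pair nu (D nu) (HD nu)) as Hw.
  set (y := D nu) in *. set (y' := Derive y) in *.
  assert (Hgap : forall n, (1 <= n <= N - 1)%nat ->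
            0 < d n /\ d n < d (S n) /\ y (d n) = 0 /\ y (d (S n)) = 0 /\
            forall x, d n < x < d (S n) -> y x <> 0).
  { intros n Hn. pose proof (enumeration_consecutive y N d n hd Hn).
    destruct hd as (H1 & H2 & _).
    pose proof (H1 n ltac:(lia)). pose proof (H1 (S n) ltac:(lia)).
    specialize (H2 n ltac:(lia)). tauto. }
  assert (HPi : forall x, y x <> 0 ->
            Pi_turan D nu x = scaled_turan nu y y' x / nu).
  { intros x Hx. apply Pi_turan_scaled; [assumption | lra | assumption]. }
  assert (Hex : forall n, exists c, (1 <= n <= N - 1)%nat ->
            d n < c < d (S n) /\ turan_slope nu y y' c = 0).
  { intros n.
    destruct (classic (1 <= n <= N - 1)%nat) as [Hn | Hn];
      [| exists 0; tauto].
    destruct (Hgap n Hn) as (Ha & Hab & Hfa & Hfb & H0).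
    destruct (turan_slope_zero nu y y' (d n) (d (S n)) ltac:(lra) Hw Ha Hab Hfa Hfb H0)
      as (c & Hc). now exists c. }
  set (gamma := fun n => proj1_sig (constructive_indefinite_description _ (Hex n))).
  assert (Hgamma : forall n, (1 <= n <= N - 1)%nat ->
            d n < gamma n < d (S n) /\ turan_slope nu y y' (gamma n) = 0).
  { intros n. unfold gamma.
    now destruct (constructive_indefinite_description _ (Hex n)). }
  set (K := scaled_turan nu y y') in *.
  assert (HPi' : forall n x, (1 <= n <= N - 1)%nat -> d n < x < d (S n) ->
            is_derive (Pi_turan D nu) x (turan_slope nu y y' x / y x ^ 2 / nu)).
  { intros n x Hn Hx. destruct (Hgap n Hn) as (Ha & Hab & Hfa & Hfb & H0).
    apply is_derive_ext_loc with (fun t => / nu * K t).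
    - apply (locally_interval _ x (d n) (d (S n))); [apply Hx | apply Hx |].
      intros t Ht1 Ht2. simpl in Ht1, Ht2.
      rewrite HPi by (apply H0; split; assumption). unfold Rdiv. apply Rmult_comm.
    - unfold Rdiv at 1. rewrite Rmult_comm. apply is_derive_scal.
      now apply (scaled_turan_derive nu y y' (d n) (d (S n))). }
  assert (Hval : forall n, (1 <= n <= N - 1)%nat ->
            Pi_turan D nu (gamma n) = K (gamma n) / nu /\
            0 < gamma n /\ 0 < K (gamma n) /\
            nu = K (gamma n)
                 + gamma n ^ 2 / 4 * (1 - / (2 * K (gamma n) + 1) ^ 2)).
  { intros n Hn. destruct (Hgap n Hn) as (Ha & Hab & Hfa & Hfb & H0).
    destruct (Hgamma n Hn) as [Hg Hs]. repeat split.
    - apply HPi, H0, Hg.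
    - lra.
    - apply (turan_positive nu y y' (d n) (d (S n))); auto; lra.
    - apply (critical_value_relation nu y y' (d n) (d (S n))); auto; lra. }
  assert (Hmin : forall n x, (1 <= n <= N - 1)%nat -> d n < x < d (S n) ->
            x <> gamma n -> Pi_turan D nu (gamma n) < Pi_turan D nu x).
  { intros n x Hn Hx Hne. destruct (Hgap n Hn) as (Ha & Hab & Hfa & Hfb & H0).
    destruct (Hgamma n Hn) as [Hg Hs].
    rewrite !HPi by now apply H0.
    apply Rmult_lt_compat_r; [apply Rinv_0_lt_compat; lra |].
    apply (scaled_turan_strict_min nu y y' (d n) (d (S n))); auto; lra. }
  assert (Hform : forall n x, (1 <= n <= N - 1)%nat -> d n < x < d (S n) ->
            y x ^ 2 - D (nu - 1) x * D (nu + 1) x = Pi_turan D nu x * y x ^ 2 /\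
            0 < y x ^ 2).
  { intros n x Hn Hx. destruct (Hgap n Hn) as (_ & _ & _ & _ & H0).
    specialize (H0 x Hx). split; [| now apply pow2_gt_0].
    unfold Pi_turan. fold y. field. assumption. }
  exists gamma. split; [| cbv zeta; split; [| split]].
  - intros n Hn. destruct (Hgap n Hn) as (Ha & Hab & Hfa & Hfb & H0).
    destruct (Hgamma n Hn) as [Hg Hs]. split; [assumption |]. split; [| split].
    + unfold is_critical_point.
      replace 0 with (turan_slope nu y y' (gamma n) / y (gamma n) ^ 2 / nu)
        by (rewrite Hs; unfold Rdiv; ring).
      now apply HPi' with n.
    + intros x Hx Hcrit.
      apply is_derive_unique in Hcrit.
      rewrite (is_derive_unique _ _ _ (HPi' n x Hn Hx)) in Hcrit.
      assert (E : turan_slope nu y y' x = 0).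
      { replace (turan_slope nu y y' x)
          with (turan_slope nu y y' x / y x ^ 2 / nu * (nu * y x ^ 2))
          by (field; split; [now apply H0 | lra]).
        rewrite Hcrit. ring. }
      pose proof (turan_slope_increasing nu y y' (d n) (d (S n)) ltac:(lra)
                    Hw Hab Hfa Hfb H0) as Hinc.
      destruct (Rtotal_order x (gamma n)) as [H | [H | H]]; [| assumption |].
      * specialize (Hinc x (gamma n)). lra.
      * specialize (Hinc (gamma n) x). lra.
    + split; [assumption |]. intros x Hx Hne. now apply Hmin.
  - intros n Hn. destruct (Hval n Hn) as (-> & Hg & HK & E).
    pose proof (critical_value_lt _ _ _ Hg HK E). split.
    + apply Rlt_div_l; lra.
    + apply Rdiv_lt_0_compat; lra.
  - intros n Hn1 Hn2.
    destruct (Hval n ltac:(lia)) as (-> & Hg & HK & E).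
    destruct (Hval (S n) ltac:(lia)) as (-> & Hg' & HK' & E').
    destruct (Hgamma n ltac:(lia)) as [[_ L1] _].
    destruct (Hgamma (S n) ltac:(lia)) as [[L2 _] _].
    apply Rmult_lt_compat_r; [apply Rinv_0_lt_compat; lra |].
    apply (critical_value_decreasing nu (gamma n) (gamma (S n))); auto; lra.
  - intros n Hn. split.
    + intros x Hx. destruct (Hform n x Hn Hx) as [-> Hpos].
      apply Rle_ge, Rmult_le_compat_r; [lra |].
      destruct (Req_dec x (gamma n)) as [-> | Hne]; [apply Rle_refl |].
      now apply Rlt_le, (Hmin n).
    + intros c Hc. destruct (Hgamma n Hn) as [Hg _].
      specialize (Hc (gamma n) Hg). destruct (Hform n (gamma n) Hn Hg) as [E Hpos].
      rewrite E in Hc. apply Rmult_le_reg_r with (y (gamma n) ^ 2); [assumption | lra].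
Qed.
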